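(* Let $p$ be a prime integer and let $F$ be a field with $\operatorname{char}(F)=p$ and finite $u_p(F)$. Then the symbol length in $H_p^2(F)$ is bounded from above by $\left\lceil\frac{u_p(F)-1}{p}\right\rceil-1$.
   Context: Let $F$ be a field of characteristic $p$. A homogeneous polynomial form of degree $p$ over $F$ of dimension $N$ is a homogeneous polynomial $\varphi(x_1,\dots,x_N)$ of degree $p$ with coefficients in $F$, regarded also as a function on $F^N$. It is isotropic if $\varphi(v)=0$ for some nonzero $v\in F^N$, and anisotropic otherwise. It is $p$-regular if there is no nonzero point $v\in F^N$ at which all the partial derivatives of $\varphi$ of order $p-1$ vanish simultaneously. $u_p(F)$ denotes the maximal dimension of an anisotropic $p$-regular form over $F$; saying that $u_p(F)$ is finite means that this maximum exists. $\Omega_F^1$ is the $F$-vector space of absolute differential forms, generated by symbols $da$ ($a\in F$) subject to $d(a+b)=da+db$ and $d(ab)=a\,db+b\,da$. The group $H_p^2(F)$ is the cokernel of the group homomorphism $\wp:\Omega_F^1\to\Omega_F^1/dF$ given by $\alpha\frac{d\beta}{\beta}\mapsto(\alpha^p-\alpha)\frac{d\beta}{\beta}$. It is isomorphic to the $p$-torsion ${}_pBr(F)$ of the Brauer group via $\alpha\frac{d\beta}{\beta}\mapsto[\alpha,\beta)_{p,F}$, where $[\alpha,\beta)_{p,F}=F\langle x,y : x^p-x=\alpha,\ y^p=\beta,\ yxy^{-1}=x+1\rangle$. The symbol length of a class is the minimal number of classes $\alpha\frac{d\beta}{\beta}$ with $\alpha\in F$, $\beta\in F^\times$ (equivalently,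 of cyclic algebras of degree $p$) needed to express it as a sum (equivalently, up to Brauer equivalence, as a tensor product), the trivial class having symbol length $0$; the symbol length of $H_p^2(F)$ is the supremum of the symbol lengths of its classes. *)

(* Defs.v *)
From HB Require Import structures.
From mathcomp Require Import all_boot all_order all_algebra archimedean.
From mathcomp Require Import ring_quotient generic_quotient boolp ring.
From mathcomp.multinomials Require Import freeg mpoly.

Set Implicit Arguments.
Unset Strict Implicit.
Unset Printing Implicit Defensive.

Import GRing.Theory.
Local Open Scope ring_scope.
Local Open Scope quotient_scope.

Section Forms.

Variable (F : fieldType).

Definition nonzero_point N (v : 'I_N -> F) := exists i, v i != 0.

Definition isotropic N (phi : {mpoly F[N]}) :=
  exists2 v : 'I_N -> F, nonzero_point v & phi.@[v] = 0.

Definition p_regular p N (phi : {mpoly F[N]}) :=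
  ~ exists2 v : 'I_N -> F, nonzero_point v &
      forall m : 'X_{1..N}, mdeg m = p.-1 -> (phi^`M[m]).@[v] = 0.

(* Forms have dimension N > 0: the zero form in no variables, which is        *)
(* vacuously anisotropic and p-regular, is not counted.                       *)
Definition anisotropic_p_regular_dim p N :=
  (0 < N)%N /\
  exists phi : {mpoly F[N]},
    [/\ phi \is p.-homog, ~ isotropic phi & p_regular p phi].

(* u_p(F) is finite and equal to u. *)
Definition u_invariant p u :=
  anisotropic_p_regular_dim p u /\
  forall N, anisotropic_p_regular_dim p N -> (N <= u)%N.

End Forms.

Section QuotientGroup.

Variable V : zmodType.

Definition subgroup (P : V -> Prop) := P 0 /\ forall x y, P x -> P y -> P (x - y).

Variables (P : V -> Prop) (hP : subgroup P).

(* The proof argument lets the closure instance below be found by unification. *)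
Definition subgroup_pred of subgroup P : V -> bool := fun x => `[< P x >].

Lemma subgroup_pred_closed : zmod_closed (subgroup_pred hP).
Proof.
case: (hP) => h0 hB; split=> [|x y]; first exact/asboolP.
by move=> /asboolP hx /asboolP hy; apply/asboolP/hB.
Qed.

HB.instance Definition _ :=
  GRing.isZmodClosed.Build V (subgroup_pred hP) subgroup_pred_closed.

Definition quotient_group : Type :=
  Quotient.quot (GRing.ZmodClosed.clone V (subgroup_pred hP) _).

HB.instance Definition _ := GRing.Zmodule.on quotient_group.

Definition proj (x : V) : quotient_group :=
  \pi_(Quotient.quot (GRing.ZmodClosed.clone V (subgroup_pred hP) _)) x.

Lemma proj_eq x y : proj x = proj y <-> P (x - y).
Proof.
split=> [/eqP|h]; first by rewrite -Quotient.idealrBE => /asboolP.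
by apply/eqP; rewrite -Quotient.idealrBE; apply/asboolP.
Qed.

Lemma proj_surj (w : quotient_group) : exists x, w = proj x.
Proof. by elim/quotW: w => x; exists x. Qed.

Lemma proj_is_zmod_morphism : zmod_morphism proj.
Proof. exact: pi_is_zmod_morphism. Qed.

HB.instance Definition _ :=
  GRing.isZmodMorphism.Build V quotient_group proj proj_is_zmod_morphism.

Definition lift_rep (w : quotient_group) : V := repr w.

Lemma lift_repK w : proj (lift_rep w) = w.
Proof. exact: reprK. Qed.

End QuotientGroup.

Arguments proj {V P} hP x : simpl never.
Arguments lift_rep {V P hP} w : simpl never.

Section Kaehler.

Variable F : fieldType.

Local Notation free := {freeg F / F}.
Local Notation gen a := (<< a >> : free).

(* The F-submodule generated by the defining relations of the symbols da, the *)
(* generator << a >> standing for da.                                         *)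
Inductive Kaehler_rel : free -> Prop :=
| Kaehler_rel0 : Kaehler_rel 0
| Kaehler_relD x y : Kaehler_rel x -> Kaehler_rel y -> Kaehler_rel (x + y)
| Kaehler_relZ a x : Kaehler_rel x -> Kaehler_rel (a *: x)
| Kaehler_rel_add a b : Kaehler_rel (gen (a + b) - (gen a + gen b))
| Kaehler_rel_mul a b : Kaehler_rel (gen (a * b) - (a *: gen b + b *: gen a)).

Lemma Kaehler_rel_subgroup : subgroup Kaehler_rel.
Proof.
split=> [|x y hx hy]; first exact: Kaehler_rel0.
by rewrite -scaleN1r; apply: Kaehler_relD => //; apply: Kaehler_relZ.
Qed.

(* Omega^1_F *)
Definition Kaehler := quotient_group Kaehler_rel_subgroup.

HB.instance Definition _ := GRing.Zmodule.on Kaehler.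

Local Notation projK := (proj Kaehler_rel_subgroup).

Definition Kaehler_scale (a : F) (w : Kaehler) : Kaehler :=
  projK (a *: lift_rep w).

Lemma Kaehler_scale_proj a (x : free) :
  Kaehler_scale a (projK x) = projK (a *: x).
Proof.
apply/proj_eq; rewrite -scalerBr; apply: Kaehler_relZ.
by apply/(proj_eq Kaehler_rel_subgroup); rewrite lift_repK.
Qed.

Lemma Kaehler_scaleA a b w :
  Kaehler_scale a (Kaehler_scale b w) = Kaehler_scale (a * b) w.
Proof.
have [x ->] := proj_surj w.
by rewrite (Kaehler_scale_proj b) !Kaehler_scale_proj scalerA.
Qed.

Lemma Kaehler_scale1 : left_id 1 Kaehler_scale.
Proof.
by move=> w; have [x ->] := proj_surj w; rewrite Kaehler_scale_proj scale1r.
Qed.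

Lemma Kaehler_scaleDr : right_distributive Kaehler_scale +%R.
Proof.
move=> a v w; have [x ->] := proj_surj v; have [y ->] := proj_surj w.
by rewrite -raddfD !Kaehler_scale_proj scalerDr raddfD.
Qed.

Lemma Kaehler_scaleDl w : {morph Kaehler_scale^~ w : a b / a + b}.
Proof.
move=> a b; have [x ->] := proj_surj w.
by rewrite !Kaehler_scale_proj scalerDl raddfD.
Qed.

HB.instance Definition _ := GRing.Zmodule_isLmodule.Build F Kaehler
  Kaehler_scaleA Kaehler_scale1 Kaehler_scaleDr Kaehler_scaleDl.

Lemma Kaehler_projZ a (x : free) : projK (a *: x) = a *: (projK x : Kaehler).
Proof. by rewrite -Kaehler_scale_proj. Qed.

Definition kdiff (a : F) : Kaehler := projK (gen a).

Lemma kdiffD a b : kdiff (a + b) = kdiff a + kdiff b.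
Proof. by rewrite -raddfD; apply/proj_eq/Kaehler_rel_add. Qed.

Lemma kdiffM a b : kdiff (a * b) = a *: kdiff b + b *: kdiff a.
Proof.
by rewrite -!Kaehler_projZ -raddfD; apply/proj_eq/Kaehler_rel_mul.
Qed.

Lemma kdiff_is_zmod_morphism : zmod_morphism kdiff.
Proof. by move=> a b; apply: (addIr (kdiff b)); rewrite -kdiffD !subrK. Qed.

HB.instance Definition _ :=
  GRing.isZmodMorphism.Build F Kaehler kdiff kdiff_is_zmod_morphism.

Lemma kdiff1 : kdiff 1 = 0.
Proof.
by apply: (addIr (kdiff 1)); rewrite add0r -{3}[1]mulr1 kdiffM scale1r.
Qed.

Lemma kdiffX a n : kdiff (a ^+ n) = (n%:R * a ^+ n.-1) *: kdiff a.
Proof.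
elim: n => [|[|n] IHn]; first by rewrite kdiff1 mul0r scale0r.
  by rewrite expr0 mulr1 scale1r.
rewrite exprS kdiffM IHn scalerA -scalerDl /=; congr (_ *: _).
by rewrite mulrCA -exprS -[n.+2]addn1 natrD mulrDl mul1r.
Qed.

Definition dlog (b : F) : Kaehler := b^-1 *: kdiff b.

Definition exact_form (w : Kaehler) := exists a, w = kdiff a.

Lemma exact_form_subgroup : subgroup exact_form.
Proof.
split=> [|_ _ [a ->] [b ->]]; first by exists 0; rewrite raddf0.
by exists (a - b); rewrite raddfB.
Qed.

(* Omega^1_F / dF *)
Definition Kaehler_mod_exact := quotient_group exact_form_subgroup.

HB.instance Definition _ := GRing.Zmodule.on Kaehler_mod_exact.

Definition mod_exact : {additive Kaehler -> Kaehler_mod_exact} :=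
  proj exact_form_subgroup.

End Kaehler.

Section InverseCartier.

Variables (F : fieldType) (p : nat) (charFp : p \in [pchar F]).

Local Notation free := {freeg F / F}.

(* The scalar a acts on frob_twist V as a ^+ p does on V. *)
Definition frob_twist of p \in [pchar F] : lmodType F -> Type := fun V => V.

Section Twist.

Variable V : lmodType F.
Local Notation Vp := (frob_twist charFp V).

HB.instance Definition _ := GRing.Zmodule.on Vp.

Definition frob_scale (a : F) (v : Vp) : Vp := (a ^+ p *: (v : V)).

Lemma frob_scaleA a b v :
  frob_scale a (frob_scale b v) = frob_scale (a * b) v.
Proof. by rewrite /frob_scale scalerA exprMn. Qed.

Lemma frob_scale1 : left_id 1 frob_scale.
Proof. by move=> v; rewrite /frob_scale expr1n scale1r. Qed.

Lemma frob_scaleDr : right_distributive frob_scale +%R.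
Proof. by move=> a v w; rewrite /frob_scale scalerDr. Qed.

Lemma frob_scaleDl v : {morph frob_scale^~ v : a b / a + b}.
Proof.
move=> a b; rewrite /frob_scale -scalerDl; congr (_ *: _).
exact: (pFrobenius_autD_comm charFp (mulrC _ _)).
Qed.

HB.instance Definition _ := GRing.Zmodule_isLmodule.Build F Vp
  frob_scaleA frob_scale1 frob_scaleDr frob_scaleDl.

End Twist.

(* The additive map sending a db to a ^+ p * b ^+ p.-1 db, on representatives. *)
Definition inv_cartier_rep : free -> Kaehler F :=
  fglift (fun b : F => b ^+ p.-1 *: kdiff b : frob_twist charFp (Kaehler F)).

Lemma inv_cartier_rep_is_zmod_morphism : zmod_morphism inv_cartier_rep.
Proof. by move=> x y; exact: (@lift_is_additive F F (frob_twist charFp (Kaehler F))). Qed.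

HB.instance Definition _ := GRing.isZmodMorphism.Build free (Kaehler F)
  inv_cartier_rep inv_cartier_rep_is_zmod_morphism.

Lemma inv_cartier_repU (a b : F) :
  inv_cartier_rep << a *g b >> = a ^+ p *: (b ^+ p.-1 *: kdiff b).
Proof. by rewrite /inv_cartier_rep liftU. Qed.

Lemma scale_freegU (a c b : F) : a *: << c *g b >> = << a * c *g b >> :> free.
Proof. by apply/eqP/freeg_eqP=> z; rewrite coeffZ !coeffU mulrA. Qed.

Lemma inv_cartier_repZ a (x : free) :
  inv_cartier_rep (a *: x) = a ^+ p *: inv_cartier_rep x.
Proof.
rewrite -[x]freeg_sumE scaler_sumr !raddf_sum; apply: eq_bigr => z _ /=.
by rewrite scale_freegU !inv_cartier_repU exprMn [RHS]scalerA. 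
Qed.

Lemma scale_exact_form a (w : Kaehler F) :
  exact_form w -> exact_form (a ^+ p *: w).
Proof.
case=> b ->; exists (a ^+ p * b).
by rewrite kdiffM kdiffX (pcharf0 charFp) mul0r scale0r scaler0 addr0.
Qed.

Lemma exact_form_freshman (b c : F) :
  exact_form ((b + c) ^+ p.-1 *: kdiff (b + c)
              - (b ^+ p.-1 *: kdiff b + c ^+ p.-1 *: kdiff c)).
Proof.
have pr_p := pcharf_prime charFp; have p_gt0 := prime_gt0 pr_p.
have [n def_p] : exists n, p = n.+1 by exists p.-1; rewrite prednK.
pose q i := ('C(p, i.+1) %/ p)%N.
have qp i : (i < n)%N -> (q i * p = 'C(p, i.+1))%N.
  by move=> i_n; rewrite divnK // prime_dvd_bin //= def_p ltnS.
have q1 i : (i < n)%N -> (q i * i.+1 = 'C(n, i))%N.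
  move=> i_n; apply/eqP; rewrite -(eqn_pmul2l p_gt0) mulnA [(p * _)%N]mulnC.
  by rewrite qp // mulnC -mul_bin_diag def_p /=.
have q2 i : (i < n)%N -> (q i * (n - i) = 'C(n, i.+1))%N.
  move=> i_n; apply/eqP; rewrite -(eqn_pmul2l p_gt0) mulnA [(p * _)%N]mulnC.
  by rewrite qp // mulnC def_p mul_bin_down subSS.
exists (\sum_(i < n) (b ^+ (n - i) * c ^+ i.+1) *+ q i).
rewrite def_p /= raddfD /= scalerDr opprD addrACA -!scalerBl exprDn.
rewrite {1}big_ord_recl big_ord_recr /= subn0 subnn bin0 binn !expr0 !mulr1n.
rewrite mulr1 mul1r [X in (X - _) *: kdiff b]addrC !addrK !scaler_suml -big_split.
rewrite raddf_sum /=; apply: eq_bigr => i _.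
rewrite raddfMn /= kdiffM !kdiffX /= !scalerA mulrnDl [RHS]addrC -!scalerMnl.
rewrite /bump /= -(q1 i) // -(q2 i) //.
congr (_ + _); rewrite [RHS]scalerMnl -[LHS]scaler_nat scalerA; congr (_ *: _).
  by rewrite natrM -subnS -[RHS]mulr_natl; ring.
by rewrite natrM -[RHS]mulr_natl; ring.
Qed.

Lemma inv_cartier_rep_rel (x : free) :
  Kaehler_rel x -> exact_form (inv_cartier_rep x).
Proof.
have exD (v w : Kaehler F) :
    exact_form v -> exact_form w -> exact_form (v + w).
  by move=> [a ->] [b ->]; exists (a + b); rewrite kdiffD.
elim=> [|y z _ hy _ hz|a y _ hy|a b|a b].
- by exists 0; rewrite !raddf0.
- by rewrite raddfD; apply: exD.
- by rewrite inv_cartier_repZ; apply: scale_exact_form.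
- rewrite raddfB raddfD /= !inv_cartier_repU !expr1n !scale1r.
  exact: exact_form_freshman.
exists 0; rewrite raddf0 raddfB raddfD /= !inv_cartier_repZ !inv_cartier_repU.
have [n def_p] : exists n, p = n.+1.
  by exists p.-1; rewrite prednK // prime_gt0 // (pcharf_prime charFp).
apply/eqP; rewrite !expr1n !scale1r kdiffM scalerDr !scalerA subr_eq0 def_p /=.
by apply/eqP; congr (_ *: _ + _ *: _); rewrite exprMn exprS; ring.
Qed.

(* The group homomorphism Omega^1_F -> Omega^1_F / dF whose value on          *)
(* a (db / b) is (a ^+ p - a) (db / b).                                       *)
Definition wp (w : Kaehler F) : Kaehler_mod_exact F :=
  mod_exact F (inv_cartier_rep (lift_rep w) - w).

Lemma wp_proj (x : free) :
  wp (proj (Kaehler_rel_subgroup F) x) =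
  mod_exact F (inv_cartier_rep x - proj (Kaehler_rel_subgroup F) x).
Proof.
rewrite /wp !raddfB; congr (_ - _); apply/proj_eq; rewrite -raddfB.
by apply/inv_cartier_rep_rel/(proj_eq (Kaehler_rel_subgroup F)); rewrite lift_repK.
Qed.

Lemma wp_is_zmod_morphism : zmod_morphism wp.
Proof.
move=> v w; have [x ->] := proj_surj v; have [y ->] := proj_surj w.
rewrite -raddfB !wp_proj -[RHS]raddfB; congr (mod_exact F _).
by rewrite !raddfB /= addrACA.
Qed.

HB.instance Definition _ := GRing.isZmodMorphism.Build
  (Kaehler F) (Kaehler_mod_exact F) wp wp_is_zmod_morphism.

Lemma wp_symbol (a b : F) :
  b != 0 -> wp (a *: dlog b) = mod_exact F ((a ^+ p - a) *: dlog b).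
Proof.
move=> b0.
have -> : a *: dlog b = proj (Kaehler_rel_subgroup F) << a / b *g b >>.
  by rewrite /dlog /kdiff scalerA -Kaehler_projZ scale_freegU mulr1.
rewrite wp_proj inv_cartier_repU; congr (mod_exact F _).
rewrite scalerBl /dlog /kdiff !scalerA -!Kaehler_projZ !scale_freegU !mulr1.
congr (_ - _); congr (proj _ << _ *g b >>).
rewrite exprMn exprVn -mulrA; congr (_ * _).
have def_p : p = p.-1.+1 by rewrite prednK // prime_gt0 // (pcharf_prime charFp).
by rewrite {1}def_p exprS invfM -mulrA mulVf ?mulr1 // expf_neq0.
Qed.

Definition wp_image (x : Kaehler_mod_exact F) := exists w, x = wp w.

Lemma wp_image_subgroup : subgroup wp_image.
Proof.
split=> [|_ _ [v ->] [w ->]]; first by exists 0; rewrite raddf0.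
by exists (v - w); rewrite raddfB.
Qed.

(* H_p^2(F), the cokernel of wp. *)
Definition H2p := quotient_group wp_image_subgroup.

HB.instance Definition _ := GRing.Zmodule.on H2p.

(* The class of a (db / b). *)
Definition symbol (a b : F) : H2p :=
  proj wp_image_subgroup (mod_exact F (a *: dlog b)).

Definition sum_of_symbols (x : H2p) n :=
  exists a b : 'I_n -> F,
    (forall i, b i != 0) /\ x = \sum_(i < n) symbol (a i) (b i).

Definition symbol_length (x : H2p) n :=
  sum_of_symbols x n /\ forall m, sum_of_symbols x m -> (n <= m)%N.

(* The supremum of the symbol lengths of the classes is finite and equal to n. *)
Definition H2p_symbol_length n :=
  (forall x, exists2 m, symbol_length x m & (m <= n)%N) /\
  (forall k, (forall x m, symbol_length x m -> (m <= k)%N) -> (n <= k)%N).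

End InverseCartier.

(* Main.v *)
(* Suppose that x is the sum of the symbols [a_i, b_i), i < n, with n minimal. *)
(* Then no a_i is of the form t^p - t, so F[X]/(X^p - X - a_i) is a field; let *)
(* N_i be its norm form. The form of dimension n p + 2                         *)
(*   c0^p - c^(p-1) c0 + (sum a_i) c^p + sum b_i N_i(g_i)                      *)
(* is p-regular, and it is anisotropic, whence n p + 2 <= u_p(F). Indeed       *)
(* [a_i, N_i(g)) = 0, so that at an isotropic vector every b_i with g_i != 0   *)
(* may be replaced with b_i N_i(g_i). If c != 0, adding b_i / c^p to these a_i *)
(* does not change the symbols and makes sum a_i of the form t^p - t, so that  *)
(* one symbol can be absorbed by the others. If c = 0, the b_i with g_i != 0   *)
(* add up to a p-th power, so that one of the db_i is a combination of the     *)
(* others. Both contradict the minimality of n.                                *)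
(* With C the companion matrix of X^p - X - a and G = g(C), the norm of g is   *)
(* det G and dlog (det G) = tr (G^-1 dG), so that [a, det G) = 0 follows from  *)
(* the compatibility of the trace of forms with the inverse Cartier operator.  *)

(* A shortest expression of a class by n > 0 symbols is turned into an anisotropic p-regular form in
   n p + 2 variables, [albert_form]. Hence n p + 2 <= u_p(F), that is n < (u_p(F) - 1) / p, and
   rounding up gives the bound ([symbol_length_u_invariant]). For n = 0 the inequality says u_p(F)
   >= 2, which holds because a form in one variable is never p-regular ([p_regular_dim_neq1]).

   Anisotropy is [isotropic_albert_form]: a nontrivial zero yields an expression by n - 1 symbols.
   Norms can be multiplied into the second slots by [symbol_horner_mx]; then one symbol is absorbed,
   by [sum_of_symbols_wp] or by [sum_of_symbols_zero_sum].

   Regularity is [albert_form_regular]. By [p_regular_dir_deriv] it suffices that the derivative of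
   the form in each nonzero direction is a nonzero polynomial; for the norm blocks this comes from
   the derivative -1 of X^p - X - a.

   No field extension is constructed: F[X]/(X^p - X - a) is replaced by the matrix algebra F[C],
   with norm [\det] and trace [\tr], and its nonzero elements are inverted by
   [artin_schreier_norm_unit]. *)
Require Import Defs.
From HB Require Import structures.
From mathcomp Require Import all_boot all_order all_algebra archimedean.
From mathcomp Require Import ring_quotient generic_quotient perm boolp ring.
From mathcomp.multinomials Require Import freeg mpoly.

Set Implicit Arguments.
Unset Strict Implicit.
Unset Printing Implicit Defensive.

Import Order.TTheory GRing.Theory Num.Theory.
Local Open Scope ring_scope.

(** * Traces of differential forms *)

Section TracePairing.

Variable F : fieldType.
Implicit Types (n : nat).

(* The trace of the matrix of differentials U *m dA. *)
Definition trace_diff n (U A : 'M[F]_n) : Kaehler F :=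
  \sum_i \sum_j U i j *: kdiff (A j i).
Arguments trace_diff {n} U A.

Lemma trace_diffDl n (A : 'M[F]_n) : {morph trace_diff^~ A : U V / U + V}.
Proof.
move=> U V; rewrite -big_split; apply: eq_bigr => i _.
by rewrite -big_split; apply: eq_bigr => j _; rewrite mxE scalerDl.
Qed.

Lemma trace_diffDr n (U : 'M[F]_n) : {morph trace_diff U : A B / A + B}.
Proof.
move=> A B; rewrite -big_split; apply: eq_bigr => i _.
by rewrite -big_split; apply: eq_bigr => j _; rewrite mxE kdiffD scalerDr.
Qed.

Lemma trace_diff_is_zmod_morphism n (U : 'M[F]_n) : zmod_morphism (trace_diff U).
Proof.
by move=> A B; apply/(addIr (trace_diff U B)); rewrite -trace_diffDr !subrK.
Qed.

HB.instance Definition _ n (U : 'M[F]_n) := GRing.isZmodMorphism.Build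
  'M[F]_n (Kaehler F) (trace_diff U) (trace_diff_is_zmod_morphism U).

(** Leibniz rule on each entry of the product; cyclicity of the trace then moves B in front of U. *)
Lemma trace_diffM n (U A B : 'M[F]_n) :
  trace_diff U (A *m B) = trace_diff (U *m A) B + trace_diff (B *m U) A.
Proof.
transitivity (\sum_i \sum_j \sum_k
    (U i j *: (A j k *: kdiff (B k i)) + U i j *: (B k i *: kdiff (A j k)))).
  apply: eq_bigr => i _; apply: eq_bigr => j _.
  rewrite mxE raddf_sum scaler_sumr; apply: eq_bigr => k _ /=.
  by rewrite kdiffM scalerDr.
rewrite (eq_bigr (fun i => \sum_j \sum_k (U i j *: (A j k *: kdiff (B k i)))
   + \sum_j \sum_k (U i j *: (B k i *: kdiff (A j k))))); last first.
  by move=> i _; rewrite -big_split; apply: eq_bigr => j _; rewrite -big_split.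
rewrite big_split; congr (_ + _).
  apply: eq_bigr => i _; rewrite exchange_big; apply: eq_bigr => k _ /=.
  rewrite mxE scaler_suml; apply: eq_bigr => j _; by rewrite scalerA.
rewrite (eq_bigr (fun i => \sum_k \sum_j (U i j *: (B k i *: kdiff (A j k)))));
  last by move=> i _; rewrite exchange_big.
rewrite exchange_big; apply: eq_bigr => k _; rewrite exchange_big.
apply: eq_bigr => j _ /=; rewrite mxE scaler_suml; apply: eq_bigr => i _.
by rewrite scalerA mulrC.
Qed.

Lemma trace_diff_scalar n (U : 'M[F]_n) a :
  trace_diff U a%:M = \tr U *: kdiff a.
Proof.
rewrite scaler_suml; apply: eq_bigr => i _; rewrite (bigD1 i) //= big1 ?addr0.
  by rewrite mxE eqxx.
by move=> j ji; rewrite mxE (negPf ji) raddf0 scaler0.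
Qed.

Lemma trace_diff1 n (A : 'M[F]_n) : trace_diff 1%:M A = kdiff (\tr A).
Proof.
rewrite raddf_sum; apply: eq_bigr => i _; rewrite (bigD1 i) //= big1 ?addr0.
  by rewrite mxE eqxx scale1r.
by move=> j ji; rewrite mxE eq_sym (negPf ji) scale0r.
Qed.

Lemma trace_diffZ n a (U A : 'M[F]_n) :
  trace_diff (a *: U) A = a *: trace_diff U A.
Proof.
rewrite scaler_sumr; apply: eq_bigr => i _; rewrite scaler_sumr.
by apply: eq_bigr => j _; rewrite mxE scalerA.
Qed.

Lemma kdiff_prod (I : finType) (f : I -> F) :
  kdiff (\prod_i f i) = \sum_i (\prod_(j | j != i) f j) *: kdiff (f i).
Proof.
suff H (r : seq I) : uniq r -> kdiff (\prod_(i <- r) f i)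
    = \sum_(i <- r) (\prod_(j <- r | j != i) f j) *: kdiff (f i).
  by rewrite H ?index_enum_uniq.
elim: r => [|i r IHr] /=; first by rewrite !big_nil kdiff1.
case/andP=> ir ur; rewrite !big_cons eqxx kdiffM IHr // addrC; congr (_ + _).
  rewrite [in RHS]big_seq_cond (eq_bigl (fun j => j \in r)).
    by rewrite -big_seq.
  by move=> j; rewrite andb_idr // => jr; apply: (memPn ir).
rewrite scaler_sumr big_seq [RHS]big_seq; apply: eq_bigr => j jr.
by rewrite big_cons eq_sym (memPn ir) // scalerA.
Qed.

(** Jacobi's formula. Differentiating the Leibniz expansion gives a sum over permutations s and rows
    i; the terms with s i = j add up to the cofactor of (i, j). *)
Lemma kdiff_det n (A : 'M[F]_n) : kdiff (\det A) = trace_diff (\adj A) A.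
Proof.
rewrite raddf_sum /= (eq_bigr (fun s : 'S_n => \sum_i
    ((-1) ^+ s * \prod_(j | j != i) A j (s j)) *: kdiff (A i (s i)))); last first.
  move=> s _; rewrite kdiffM kdiff_prod scaler_sumr.
  have -> : kdiff ((-1) ^+ s : F) = 0.
    by case: (s : bool); rewrite ?expr1 ?expr0 ?raddfN /= kdiff1 ?oppr0.
  by rewrite scaler0 addr0; apply: eq_bigr => i _; rewrite scalerA.
rewrite exchange_big [RHS]exchange_big; apply: eq_bigr => i _ /=.
rewrite (partition_big (fun s : 'S_n => s i) xpredT) //=.
apply: eq_bigr => j _; rewrite mxE expand_cofactor scaler_suml.
apply: eq_bigr => s /eqP sij; rewrite sij; congr ((_ * _) *: _).
by apply: eq_bigl => k; rewrite eq_sym.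
Qed.

End TracePairing.

(** * The trace commutes with Frobenius *)

Section FrobeniusTrace.

Variables (R : comNzRingType) (p : nat) (charRp : p \in [pchar R]).

Lemma pchar_matrix n : p \in [pchar 'M[R]_n.+1].
Proof.
have /andP[pr_p /eqP p0] := charRp; rewrite inE pr_p /=.
by apply/eqP; rewrite -[1]/1%:M -raddfMn /= p0 raddf0.
Qed.

Lemma det_exp n (A : 'M[R]_n.+1) k : \det (A ^+ k) = \det A ^+ k.
Proof. by elim: k => [|k IHk]; rewrite ?det1 // !exprS detM IHk. Qed.

End FrobeniusTrace.

(** The characteristic polynomials satisfy chi_A(X)^p = chi_{A^p}(X^p); the traces are read off from
    the second highest coefficients. *)
Lemma trace_exp_pchar (R : comNzRingType) p (charRp : p \in [pchar R]) n
  (A : 'M[R]_n.+1) : \tr (A ^+ p) = \tr A ^+ p.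
Proof.
have pr_p := pcharf_prime charRp; have p_gt0 := prime_gt0 pr_p.
have charXp : p \in [pchar {poly R}] by rewrite pchar_poly.
(* Since X and A commute, (X - A)^p = X^p - A^p; take determinants. *)
have key : char_poly A ^+ p = char_poly (A ^+ p) \Po 'X^p.
  rewrite /char_poly -det_exp /char_poly_mx -det_map_mx; congr (\det _).
  have cXA : GRing.comm ('X%:M : 'M_n.+1) (map_mx polyC A).
    exact: comm_mx_sym (comm_mx_scalar _ _).
  rewrite -[_ ^+ p](pFrobenius_autE (pchar_matrix charXp n)).
  rewrite pFrobenius_autB_comm // !pFrobenius_autE map_mxB.
  congr (_ - _).
    rewrite map_scalar_mx /= comp_polyX; elim: (p) => // k IHk.
    by rewrite exprS IHk -[_ * _]/(_ *m _) -scalar_mxM -exprS.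
  rewrite -rmorphXn /=; apply/matrixP=> i j; rewrite !mxE /=; exact/esym/comp_polyC.
have := congr1 (fun P : {poly R} => P`_(n * p)) key.
rewrite coef_comp_poly_Xn // dvdn_mull // mulnK //.
rewrite [in RHS]char_poly_trace //.
have -> (P : {poly R}) : (P ^+ p)`_(n * p) = P`_n ^+ p.
  rewrite -{1}[P]coefK poly_def -(pFrobenius_autE charXp) raddf_sum coef_sum /=.
  case: (ltnP n (size P)) => nP; last first.
    rewrite big1 => [|i _]; first by rewrite nth_default // expr0n gtn_eqF.
    rewrite pFrobenius_autE exprZn -exprM coefZ coefXn eqn_pmul2r // gtn_eqF.
      by rewrite mulr0.
    by rewrite (leq_trans (ltn_ord i)).
  rewrite (bigD1 (Ordinal nP)) //= big1 ?addr0 => [|i /negPf iP].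
    by rewrite pFrobenius_autE exprZn -exprM coefZ coefXn eqxx mulr1.
  rewrite pFrobenius_autE exprZn -exprM coefZ coefXn eqn_pmul2r //.
  by rewrite eq_sym -[n]/(val (Ordinal nP)) val_eqE iP mulr0.
rewrite char_poly_trace // -(pFrobenius_autE charRp) pFrobenius_autN.
by rewrite pFrobenius_autE => /oppr_inj.
Qed.

(** * Symbols of norms *)

Section SymbolCalculus.

Variables (F : fieldType) (p : nat) (charFp : p \in [pchar F]).

Local Notation symbol := (symbol charFp).

Definition form_class (w : Kaehler F) : H2p charFp :=
  proj (wp_image_subgroup charFp) (mod_exact F w).

Lemma form_class_is_zmod_morphism : zmod_morphism form_class.
Proof. by move=> v w; rewrite /form_class !raddfB. Qed.

HB.instance Definition _ := GRing.isZmodMorphism.Build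
  (Kaehler F) (H2p charFp) form_class form_class_is_zmod_morphism.

Lemma form_class_kdiff a : form_class (kdiff a) = 0.
Proof.
rewrite /form_class -[RHS](raddf0 (proj (wp_image_subgroup charFp))).
congr (proj _ _); rewrite -[RHS](raddf0 (mod_exact F)); apply/proj_eq.
by rewrite subr0; exists a.
Qed.

(* The inverse Cartier operator, a db |-> a ^ p b ^ (p - 1) db. *)
Definition inv_cartier (w : Kaehler F) : Kaehler_mod_exact F :=
  wp charFp w + mod_exact F w.

Lemma inv_cartier_is_zmod_morphism : zmod_morphism inv_cartier.
Proof. by move=> v w; rewrite /inv_cartier !raddfB /= opprD addrACA. Qed.

HB.instance Definition _ := GRing.isZmodMorphism.Build
  (Kaehler F) (Kaehler_mod_exact F) inv_cartier inv_cartier_is_zmod_morphism.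

Lemma inv_cartierE a b :
  inv_cartier (a *: kdiff b) = mod_exact F (a ^+ p *: (b ^+ p.-1 *: kdiff b)).
Proof.
have -> : a *: kdiff b = proj (Kaehler_rel_subgroup F) << a *g b >>.
  by rewrite /kdiff -Kaehler_projZ scale_freegU mulr1.
by rewrite /inv_cartier wp_proj inv_cartier_repU raddfB /= subrK.
Qed.

(** As [wp] is the inverse Cartier operator minus the projection, a form and its image under that
    operator have the same class in the cokernel. *)
Lemma form_class_inv_cartier v w :
  inv_cartier v = mod_exact F w -> form_class v = form_class w.
Proof.
move=> vw; apply/eqP; rewrite eq_sym -subr_eq0 -raddfB; apply/eqP.
rewrite /form_class -[RHS](raddf0 (proj (wp_image_subgroup charFp))).
by apply/proj_eq; exists v; rewrite subr0 raddfB /= -vw addrK.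
Qed.

Lemma dlogM (a b : F) : a != 0 -> b != 0 -> dlog (a * b) = dlog a + dlog b.
Proof.
move=> a0 b0; rewrite /dlog kdiffM scalerDr !scalerA addrC; congr (_ + _).
  by rewrite invfM divfK.
by rewrite invfM mulrAC mulVf // mul1r.
Qed.

Lemma symbolDl b : {morph symbol^~ b : a a' / a + a'}.
Proof. by move=> a a'; rewrite -[RHS](raddfD form_class) -scalerDl. Qed.

Lemma symbol0l b : symbol 0 b = 0.
Proof. by rewrite -[LHS]/(form_class _) scale0r raddf0. Qed.

Lemma symbolNl a b : symbol (- a) b = - symbol a b.
Proof. by apply: (addIr (symbol a b)); rewrite -symbolDl !addNr symbol0l. Qed.

Lemma symbol_suml (I : Type) (r : seq I) (P : pred I) f b :
  symbol (\sum_(i <- r | P i) f i) b = \sum_(i <- r | P i) symbol (f i) b.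
Proof. exact: (big_morph _ (symbolDl b) (symbol0l b)). Qed.

Lemma symbolMr a b c : b != 0 -> c != 0 ->
  symbol a (b * c) = symbol a b + symbol a c.
Proof.
by move=> b0 c0; rewrite -[RHS](raddfD form_class) -scalerDr -dlogM.
Qed.

Lemma symbol_wp a b : b != 0 -> symbol (a ^+ p - a) b = 0.
Proof.
move=> b0; rewrite /Defs.symbol -[RHS](raddf0 (proj (wp_image_subgroup charFp))).
by apply/proj_eq; exists (a *: dlog b); rewrite subr0 wp_symbol.
Qed.

(** The form is a^p db = d(a^p b), which is exact. *)
Lemma symbol_diag a b : b != 0 -> symbol (a ^+ p * b) b = 0.
Proof.
move=> b0; rewrite -[LHS]/(form_class _) /dlog scalerA mulfK //.
have exact_db : exact_form (kdiff b) by exists b.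
have [c ->] := scale_exact_form charFp a exact_db.
exact: form_class_kdiff.
Qed.

End SymbolCalculus.

Lemma prime_bin_quotient n i : prime n.+1 -> (i < n)%N ->
  exists q, (q * i.+1 = 'C(n, i))%N /\ (q * (n - i) = 'C(n, i.+1))%N.
Proof.
move=> pr_n i_n; exists ('C(n.+1, i.+1) %/ n.+1)%N.
have dvdC : (n.+1 %| 'C(n.+1, i.+1))%N by rewrite prime_dvd_bin //= ltnS.
rewrite !divn_mulAC // mulnC -mul_bin_diag mulKn // -subSS mulnC.
by rewrite -mul_bin_down mulKn.
Qed.

(** * Norms from F[C] and the inverse Cartier operator *)

Section NormSymbol.

Variables (F : fieldType) (q : nat) (charFp : q.+1 \in [pchar F]).
Variables (n : nat) (C : 'M[F]_n.+1).

Local Notation p := q.+1.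
Local Notation rho := (horner_mx C).
Implicit Types u v a b : {poly F}.

(** The trace to F of the form u da of the commutative algebra F[C]. Elements are given by
    polynomials, which allows [ring] and induction on polynomials. *)
Local Definition tau u a : Kaehler F := trace_diff (rho u) (rho a).

Local Lemma tauDr u : {morph tau u : a b / a + b}.
Proof. by move=> a b; rewrite /tau raddfD trace_diffDr. Qed.

Local Lemma tauDl a : {morph tau^~ a : u v / u + v}.
Proof. by move=> u v; rewrite /tau raddfD trace_diffDl. Qed.

Local Lemma tauMnl a u k : tau (u *+ k) a = tau u a *+ k.
Proof.
elim: k => [|k IHk]; last by rewrite !mulrS tauDl IHk.
by apply: (addIr (tau 0 a)); rewrite !mulr0n -tauDl !add0r.
Qed.

Local Lemma tauMnr u a k : tau u (a *+ k) = tau u a *+ k.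
Proof. by rewrite /tau !raddfMn. Qed.

Local Lemma tau_suml k (u : 'I_k -> {poly F}) a :
  tau (\sum_i u i) a = \sum_i tau (u i) a.
Proof. exact: (big_morph _ (tauDl a) (tauMnl a 0 0)). Qed.

Local Lemma tau_sumr k u (a : 'I_k -> {poly F}) :
  tau u (\sum_i a i) = \sum_i tau u (a i).
Proof. by rewrite /tau !raddf_sum. Qed.

Local Lemma tauM u a b : tau u (a * b) = tau (u * a) b + tau (u * b) a.
Proof.
have rhoM v w : rho v *m rho w = rho (v * w) by rewrite rmorphM.
by rewrite /tau -rhoM trace_diffM !rhoM [b * u]mulrC.
Qed.

Local Lemma tauXn u a k : tau u (a ^+ k) = tau (u * a ^+ k.-1 *+ k) a.
Proof.
elim: k => [|k IHk] in u *.
  by rewrite expr0 tauMnl mulr0n /tau rmorph1 trace_diff_scalar kdiff1 scaler0.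
rewrite exprS tauM IHk -tauDl; congr (tau _ a).
case: k {IHk} => [|k] /=; first by rewrite expr0 mulr0n add0r mulr1n.
by rewrite -mulrA -exprS [RHS]mulrS addrC.
Qed.

Local Lemma tau_exp_p u a : tau u (a ^+ p) = 0.
Proof.
have charXp : p \in [pchar {poly F}] by rewrite pchar_poly.
by rewrite tauXn -mulr_natr (pcharf0 charXp) mulr0 -(mulr0n 1) tauMnl mulr0n.
Qed.

(** As d(u^p) contributes nothing, the form is d(tr(u^p a)). *)
Local Lemma tau_exact u a : exact_form (tau (u ^+ p) a).
Proof.
exists (\tr (rho (u ^+ p * a))).
have -> : kdiff (\tr (rho (u ^+ p * a))) = tau 1 (u ^+ p * a).
  by rewrite /tau rmorph1 trace_diff1.
by rewrite tauM tau_exp_p addr0 mul1r.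
Qed.

(** The difference of the forms x^(p-1) dx is d of the sum of the a^(p-j) b^j with coefficients
    'C(p, j) / p, for 0 < j < p; multiplied by u^p, its trace is exact by [tau_exact]. The integers
    [k i] below are these coefficients, with j = i + 1. *)
Local Lemma tau_freshman u a b :
  exact_form (tau (u ^+ p * (a + b) ^+ q) (a + b)
              - (tau (u ^+ p * a ^+ q) a + tau (u ^+ p * b ^+ q) b)).
Proof.
have bin_q i : {k | (i < q)%N ->
    (k * i.+1 = 'C(q, i))%N /\ (k * (q - i) = 'C(q, i.+1))%N}.
  have [i_q|_] := ltnP i q; last by exists 0%N.
  by have /cid [k kP] := prime_bin_quotient (pcharf_prime charFp) i_q; exists k.
pose k i := sval (bin_q i); have kP i : (i < q)%N -> _ := svalP (bin_q i).
suff -> : tau (u ^+ p * (a + b) ^+ q) (a + b)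
              - (tau (u ^+ p * a ^+ q) a + tau (u ^+ p * b ^+ q) b)
  = tau (u ^+ p) (\sum_(i < q) (a ^+ (q - i) * b ^+ i.+1) *+ k i).
  exact: tau_exact.
have -> : tau (u ^+ p) (\sum_(i < q) (a ^+ (q - i) * b ^+ i.+1) *+ k i)
  = tau (u ^+ p * \sum_(i < q) (a ^+ (q - i.+1) * b ^+ i.+1) *+ 'C(q, i.+1)) a
  + tau (u ^+ p * \sum_(i < q) (a ^+ (q - i) * b ^+ i) *+ 'C(q, i)) b.
  rewrite tau_sumr !mulr_sumr !tau_suml.
  rewrite -big_split; apply: eq_bigr => i _ /=.
  rewrite tauMnr tauM !tauXn /= !mulrnAr !tauMnl addrC mulrnDl -!mulrnA.
  rewrite ![(_ * k i)%N]mulnC (kP i _).1 // (kP i _).2 // subnS.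
  by congr (tau _ _ *+ _ + tau _ _ *+ _); ring.
have Sa : (a + b) ^+ q =
    a ^+ q + \sum_(i < q) (a ^+ (q - i.+1) * b ^+ i.+1) *+ 'C(q, i.+1).
  by rewrite exprDn big_ord_recl /= subn0 bin0 expr0 mulr1.
have Sb : (a + b) ^+ q =
    \sum_(i < q) (a ^+ (q - i) * b ^+ i) *+ 'C(q, i) + b ^+ q.
  by rewrite exprDn big_ord_recr /= subnn binn expr0 mul1r.
rewrite tauDr {1}Sa Sb !mulrDr !tauDl [tau (u ^+ p * a ^+ q) a + _]addrC.
by rewrite opprD addrACA addrK addrK.
Qed.

(** The polynomials a for which this holds for all u are closed under sums and products, so
    constants and X suffice. *)
Lemma inv_cartier_tau (c : F) u a : C ^+ p - C = c%:M ->
  inv_cartier charFp (tau u a) = mod_exact F (tau (u ^+ p * a ^+ q) a).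
Proof.
move=> Cc.
pose good a := forall u,
  inv_cartier charFp (tau u a) = mod_exact F (tau (u ^+ p * a ^+ q) a).
have goodD b1 b2 : good b1 -> good b2 -> good (b1 + b2).
  move=> h1 h2 v; rewrite tauDr raddfD /= h1 h2 -raddfD; apply/esym/proj_eq.
  exact: tau_freshman.
have goodM b1 b2 : good b1 -> good b2 -> good (b1 * b2).
  move=> h1 h2 v; rewrite tauM raddfD /= h1 h2 -raddfD tauM; congr (mod_exact F _).
  congr (tau _ _ + tau _ _); rewrite !exprMn; first by rewrite [b1 ^+ p]exprS; ring.
  by rewrite [b2 ^+ p]exprS; ring.
have goodC x : good x%:P.
  move=> v; rewrite /tau horner_mx_C !trace_diff_scalar inv_cartierE.
  congr (mod_exact F _); rewrite scalerA; congr (_ *: _).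
  have -> : v ^+ p * x%:P ^+ q = x ^+ q *: v ^+ p.
    by rewrite -mul_polyC rmorphXn mulrC.
  rewrite linearZ /= mxtraceZ rmorphXn /=.
  by rewrite trace_exp_pchar // mulrC.
(* In F[C] one has X = X^p - c. The p-th power has zero differential, so X reduces to the constant
   -c. *)
have goodX : good 'X.
  have rhoX : rho 'X = rho ('X ^+ p + (- c)%:P).
    by rewrite polyCN rmorphB rmorphXn /= horner_mx_C horner_mx_X -Cc /= subKr.
  have tauX v : tau v 'X = tau v ('X ^+ p + (- c)%:P) by rewrite /tau rhoX.
  move=> v; rewrite tauX.
  have -> : tau (v ^+ p * 'X ^+ q) 'X =
      tau (v ^+ p * ('X ^+ p + (- c)%:P) ^+ q) ('X ^+ p + (- c)%:P).
    rewrite /tau -rhoX; congr (trace_diff _ _); rewrite !rmorphM; congr (_ * _).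
    by rewrite [LHS]rmorphXn [RHS]rmorphXn; congr (_ ^+ _).
  apply: (goodD); last exact: goodC.
  by move=> w; rewrite !tau_exp_p !raddf0.
suff: good a by apply.
elim/poly_ind: a => [|a x IHa]; first by rewrite -polyC0; apply: goodC.
by apply: goodD => //; apply: goodM.
Qed.

(** By Jacobi's formula c dlog(det g) = tr(c h dg), and c = X^p - X in F[C]. The inverse Cartier
    operator sends tr(X h dg) to tr(X^p h^p g^(p-1) dg), which is tr(X^p h dg) because h g = 1. So
    the two terms have equal classes and cancel. *)
Lemma symbol_horner_mx (c : F) g h :
  C ^+ p - C = c%:M -> rho (h * g) = 1 -> symbol charFp c (\det (rho g)) = 0.
Proof.
move=> Cc hg.
have det0 : \det (rho g) != 0.
  apply/eqP=> dg; have := congr1 determinant hg.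
  by rewrite rmorphM det_mulmx dg mulr0 det1 => /esym/eqP; rewrite oner_eq0.
have invg : (\det (rho g))^-1 *: \adj (rho g) = rho h.
  have <- : (\det (rho g))^-1 *: \adj (rho g) *m rho (h * g) = rho h.
    rewrite [h * g]mulrC rmorphM mulmxA -scalemxAl mul_adj_mx -mul_scalar_mx.
    by rewrite -scalar_mxM mulVf // mul1mx.
  by rewrite hg mulmx1.
have rhoXp : rho ('X ^+ p * h) = rho ('X * h) + c *: rho h.
  rewrite !rmorphM rmorphXn /= horner_mx_X -mul_scalar_mx -Cc mulmxBl.
  by rewrite addrC subrK.
have -> : symbol charFp c (\det (rho g)) =
    form_class charFp (tau ('X ^+ p * h) g) - form_class charFp (tau ('X * h) g).
  rewrite -raddfB -[LHS]/(form_class charFp _) /dlog kdiff_det -trace_diffZ invg.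
  by rewrite /tau rhoXp trace_diffDl trace_diffZ addrC addKr.
rewrite [X in _ - X](form_class_inv_cartier (inv_cartier_tau _ _ Cc)).
apply/eqP; rewrite subr_eq0; apply/eqP; congr (form_class _ (trace_diff _ _)).
have -> : ('X * h) ^+ p * g ^+ q = 'X ^+ p * h * (h * g) ^+ q.
  by rewrite !exprMn [h ^+ p]exprS; ring.
rewrite [RHS]rmorphM /= [rho ((h * g) ^+ q)]rmorphXn /= hg expr1n mulr1 //.
Qed.

End NormSymbol.

(** * Shortening sums of symbols *)

Lemma exists_char_poly (R : comNzRingType) n (f : {poly R}) :
  f \is monic -> size f = n.+1 -> exists C : 'M[R]_n, char_poly C = f.
Proof.
move=> f_mon f_sz; have -> : n = (size f).-1 by rewrite f_sz.
by exists (companionmx f); rewrite companionmxK.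
Qed.

(** * Irreducibility of X^p - X - c, in matrix form *)

Section ArtinSchreier.

Variables (F : fieldType) (q : nat) (charFp : q.+1 \in [pchar F]).
Local Notation p := q.+1.
Variable c : F.

Definition artin_schreier_poly : {poly F} := 'X^p - ('X + c%:P).

Let q_gt0 : (0 < q)%N.
Proof. by rewrite -ltnS prime_gt1 // (pcharf_prime charFp). Qed.

Lemma size_artin_schreier_tail : (size ('X + c%:P : {poly F})%R < p.+1)%N.
Proof. by rewrite size_XaddC !ltnS. Qed.

Lemma size_artin_schreier_poly : size artin_schreier_poly = p.+1.
Proof.
by rewrite size_polyDl size_polyXn // size_polyN size_artin_schreier_tail.
Qed.

Lemma artin_schreier_poly_monic : artin_schreier_poly \is monic.
Proof.
rewrite monicE lead_coefDl ?lead_coefXn // size_polyN size_polyXn.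
exact: size_artin_schreier_tail.
Qed.

Lemma horner_mx_artin_schreier n (C : 'M[F]_n.+1) :
  horner_mx C artin_schreier_poly = C ^+ p - C - c%:M.
Proof.
by rewrite rmorphB rmorphD rmorphXn /= horner_mx_X horner_mx_C opprD addrA.
Qed.

(** If g is coprime to X^p - X - c, Bezout inverts it in F[C]. Otherwise the monic gcd k has a
    degree d with 0 < d < p, and its companion matrix Y satisfies Y^p - Y = c. Taking traces, t =
    tr(Y) / d satisfies t^p - t = c, a contradiction. *)
Lemma artin_schreier_norm_unit (C : 'M[F]_p) (g : {poly F}) :
    (forall t, t ^+ p - t != c) -> char_poly C = artin_schreier_poly ->
    g != 0 -> (size g <= p)%N ->
  exists h, horner_mx C (h * g) = 1.
Proof.
move=> c_wp charC g0 g_sz.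
have [/Bezout_eq1_coprimepP [[h k] /= hgkf]|gNf] :=
    boolP (coprimep g artin_schreier_poly).
  exists h; have := congr1 (horner_mx C) hgkf.
  rewrite rmorphD rmorph1 /= [horner_mx C (k * _)]rmorphM -charC /=.
  by rewrite Cayley_Hamilton mulr0 addr0.
pose d := gcdp g artin_schreier_poly.
have d0 : d != 0 by rewrite gcdp_eq0 negb_and g0.
have d_sz : (size d <= p)%N by apply: leq_trans (leq_gcdpl _ g0) g_sz.
have d_gt1 : (1 < size d)%N.
  by rewrite ltn_neqAle eq_sym gNf /= size_poly_gt0.
pose k := (lead_coef d)^-1 *: d.
have lead_d0 : (lead_coef d)^-1 != 0 by rewrite invr_eq0 lead_coef_eq0.
have k_mon : k \is monic by rewrite monicE lead_coefZ mulVf // lead_coef_eq0.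
have k_dvd : k %| artin_schreier_poly by rewrite dvdpZl // dvdp_gcdr.
have [m m_sz] : exists m, size d = m.+2.
  by exists (size d).-2; case: (size d) d_gt1 => [|[]].
have k_sz : size k = m.+2 by rewrite size_scale.
have [Y charY] := exists_char_poly k_mon k_sz.
have wpY : Y ^+ p - Y = c%:M.
  apply/eqP; rewrite -subr_eq0 -horner_mx_artin_schreier; apply/eqP.
  have /dvdpP [r ->] := k_dvd.
  by rewrite rmorphM -charY /= Cayley_Hamilton mulr0.
have := congr1 mxtrace wpY; rewrite raddfB /= trace_exp_pchar // mxtrace_scalar.
have m0 : m.+1%:R != 0 :> F.
  by rewrite -(dvdn_pcharf charFp) gtnNdvd // -ltnS -m_sz.
(* The degree lies in the prime field, so Frobenius fixes it. *)
move=> trY; have /eqP[] := c_wp (\tr Y / m.+1%:R).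
apply: (mulIf m0); rewrite mulrBl divfK // [c * _]mulr_natr -trY; congr (_ - _).
rewrite expr_div_n -(pFrobenius_autE charFp m.+1%:R) pFrobenius_aut_nat.
by rewrite divfK.
Qed.

End ArtinSchreier.

(** * Absorbing one symbol into the others *)

Section SymbolReduction.

Variables (F : fieldType) (p : nat) (charFp : p \in [pchar F]).
Local Notation symbol := (symbol charFp).

Let p_gt0 : (0 < p)%N.
Proof. exact/prime_gt0/(pcharf_prime charFp). Qed.

Lemma symbol_scaled a b : b != 0 ->
  symbol (a * b) b = form_class charFp (a *: kdiff b).
Proof. by move=> b0; rewrite -[LHS]/(form_class _ _) /dlog scalerA mulfK. Qed.

Lemma kdiff_exp_p a : kdiff (a ^+ p) = 0 :> Kaehler F.
Proof. by rewrite kdiffX (pcharf0 charFp) mul0r scale0r. Qed.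

(** The relation gives [a_0, b_0) = - sum_{i > 0} [a_i, b_0), so that the whole sum is the sum of
    the [a_i, b_i / b_0) with i > 0. *)
Lemma sum_of_symbols_wp m (a b : 'I_m.+1 -> F) t :
    (forall i, b i != 0) -> \sum_i a i + (t ^+ p - t) = 0 ->
  sum_of_symbols (\sum_i symbol (a i) (b i)) m.
Proof.
move=> b0 sum_a; exists (fun i => a (fintype.lift ord0 i)).
exists (fun i => b (fintype.lift ord0 i) / b ord0).
split=> [i|]; first by rewrite mulf_neq0 ?invr_eq0.
rewrite big_ord_recl.
have -> : a ord0 = - (\sum_i a (fintype.lift ord0 i) + (t ^+ p - t)).
  by apply/eqP; rewrite -addr_eq0 addrA -big_ord_recl sum_a.
rewrite symbolNl symbolDl symbol_wp // addr0 symbol_suml addrC -sumrB.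
apply: eq_bigr => i _; apply: (addIr (symbol (a (fintype.lift ord0 i)) (b ord0))).
by rewrite subrK -symbolMr ?mulf_neq0 ?invr_eq0 // divfK.
Qed.

(** With r = a_k / b_k, the symbol [a_k, b_k) is the class of r db_k. As d(t^p) = 0, db_k is minus
    the sum of the other selected db_i, and r db_i has class [r b_i, b_i), which merges with [a_i,
    b_i). *)
Lemma sum_of_symbols_zero_sum m (a b : 'I_m.+1 -> F) (e : pred 'I_m.+1) k t :
    (forall i, b i != 0) -> e k -> t ^+ p + \sum_(i | e i) b i = 0 ->
  sum_of_symbols (\sum_i symbol (a i) (b i)) m.
Proof.
move=> b0 ek sum_b; pose r := a k / b k.
pose s i := if e (fintype.lift k i) then r * b (fintype.lift k i) else 0.
exists (fun i => a (fintype.lift k i) - s i), (fun i => b (fintype.lift k i)).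
split=> //.
rewrite (bigD1_ord k) //=.
have -> : symbol (a k) (b k) =
    - \sum_i symbol (s i) (b (fintype.lift k i)).
  rewrite -{1}[a k](divfK (b0 k)) symbol_scaled // -/r.
  have -> : b k =
      - (t ^+ p + \sum_(i | e (fintype.lift k i)) b (fintype.lift k i)).
    apply/eqP; rewrite -addr_eq0 addrCA; apply/eqP.
    by rewrite (bigD1_ord k) in sum_b.
  rewrite [kdiff (- _)]raddfN /= kdiffD kdiff_exp_p add0r scalerN raddfN /=.
  rewrite [kdiff _]raddf_sum /=.
  congr (- _); rewrite scaler_sumr raddf_sum big_mkcond /=.
  apply: eq_bigr => i _; rewrite /s; case: ifP => _; last by rewrite symbol0l.
  by rewrite symbol_scaled.
rewrite addrC -sumrB; apply: eq_bigr => i _.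
by rewrite symbolDl symbolNl.
Qed.

(** Here N_i stands for the norm in block i and [e] selects the nonzero blocks. After each selected
    b_i absorbs N_i, the case c = 0 is [sum_of_symbols_zero_sum], and dividing by c^p otherwise
    leads to [sum_of_symbols_wp] with t = c0 / c. *)
Lemma sum_of_symbols_isotropic m (a b N : 'I_m.+1 -> F) (e : pred 'I_m.+1) c0 c :
    (forall i, b i != 0) -> (forall i, e i -> N i != 0) ->
    (forall i, e i -> symbol (a i) (N i) = 0) -> c != 0 \/ (exists k, e k) ->
    c0 ^+ p - c ^+ p.-1 * c0 + (\sum_i a i) * c ^+ p
      + \sum_(i | e i) b i * N i = 0 ->
  sum_of_symbols (\sum_i symbol (a i) (b i)) m.
Proof.
move=> b0 N0 symN c_e iso; pose b' i := if e i then b i * N i else b i.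
have b'0 i : b' i != 0 by rewrite /b'; case: ifP => // /N0; apply: mulf_neq0.
have -> : \sum_i symbol (a i) (b i) = \sum_i symbol (a i) (b' i).
  apply: eq_bigr => i _; rewrite /b'; case: ifP => // ei.
  by rewrite symbolMr ?N0 // symN // addr0.
have sum_b' : \sum_(i | e i) b i * N i = \sum_(i | e i) b' i.
  by apply: eq_bigr => i ei; rewrite /b' ei.
rewrite {}sum_b' {symN N0} in iso; move: b' b'0 iso => {N b0}b b0 iso.
have [c_0|c_neq0] := eqVneq c 0.
  case: c_e => [|[k ek]]; first by rewrite c_0 eqxx.
  apply: (@sum_of_symbols_zero_sum _ a b e k c0) => //; rewrite -[RHS]iso c_0.
  (* As p >= 2, the term c^(p-1) c0 vanishes with c. *)
  have [[|p2] def_p] : exists p2, p = p2.+1 by exists p.-1; rewrite prednK.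
    by have := pcharf_prime charFp; rewrite def_p.
  by rewrite def_p !expr0n mulr0 mul0r subr0 addr0.
pose a' i := a i + (if e i then (c^-1) ^+ p * b i else 0).
have -> : \sum_i symbol (a i) (b i) = \sum_i symbol (a' i) (b i).
  apply: eq_bigr => i _; rewrite symbolDl; case: ifP => _.
    by rewrite symbol_diag // addr0.
  by rewrite symbol0l addr0.
apply: (@sum_of_symbols_wp _ _ _ (c0 / c)) => //.
apply: (mulIf (expf_neq0 p c_neq0)); rewrite mul0r -[RHS]iso big_split /=.
rewrite -big_mkcond -mulr_sumr !mulrDl !mulNr.
rewrite -exprMn divfK // mulrAC -exprMn mulVf // expr1n mul1r.
have -> : c0 / c * c ^+ p = c ^+ p.-1 * c0.
  by rewrite -{1}(prednK p_gt0) exprS mulrA divfK // mulrC.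
by rewrite addrC addrA.
Qed.

End SymbolReduction.

(** * Regularity of forms *)

Lemma prime_dvdn_fact p k : prime p -> (p %| k`!)%N = (p <= k)%N.
Proof.
move=> pr_p; apply/idP/idP => [|p_k]; last by rewrite dvdn_fact ?prime_gt0.
elim: k => [|k IHk]; first by rewrite dvdn1 => /eqP p1; rewrite p1 in pr_p.
by rewrite factS Euclid_dvdM // => /orP[/dvdn_leq->|/IHk/leqW].
Qed.

Section PRegular.

Variables (F : fieldType) (N : nat).
Implicit Types (phi : {mpoly F[N]}) (u v : 'I_N -> F).

Definition dir_deriv v phi := \sum_i v i *: phi^`M(i).

Definition on_line u v : {mpoly F[N]} -> {poly F} :=
  mmap polyC (fun i => (u i)%:P + v i *: 'X).

HB.instance Definition _ u v := GRing.RMorphism.on (on_line u v).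

Lemma horner_on_line0 u v phi : (on_line u v phi).[0] = phi.@[u].
Proof.
rewrite horner_sum mevalE; apply: eq_bigr => m _.
rewrite hornerM hornerC horner_prod; congr (_ * _); apply: eq_bigr => i _.
by rewrite horner_exp !hornerE.
Qed.

(** Both sides obey the Leibniz rule, so constants and variables suffice. Choosing u then tests
    whether the directional derivative vanishes. *)
Lemma deriv_on_line0 u v phi :
  (on_line u v phi)^`().[0] = (dir_deriv v phi).@[u].
Proof.
pose good phi := (on_line u v phi)^`().[0] = (dir_deriv v phi).@[u].
have goodD p q : good p -> good q -> good (p + q).
  rewrite /good => hp hq; rewrite rmorphD derivD hornerD hp hq -mevalD.
  congr meval; rewrite -big_split; apply: eq_bigr => i _.
  by rewrite mderivD scalerDr.
have goodM p q : good p -> good q -> good (p * q).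
  rewrite /good => hp hq; rewrite rmorphM derivM hornerD !hornerM hp hq.
  rewrite !horner_on_line0 -!mevalM -mevalD; congr meval.
  rewrite mulr_suml mulr_sumr -big_split; apply: eq_bigr => i _.
  by rewrite mderivM scalerDr scalerAl scalerAr.
have goodC c : good c%:MP.
  rewrite /good /on_line mmapC derivC horner0 /dir_deriv big1 ?raddf0 // => i _.
  by rewrite mderivC scaler0.
have goodX i : good 'X_i.
  rewrite /good /on_line mmapX mmap1U derivD derivC add0r derivZ derivX.
  rewrite hornerZ hornerC mulr1 /dir_deriv (bigD1 i) //= big1 ?addr0 => [|j ji].
    rewrite mderivX mnm1E eqxx scale1r -{1}[U_(i)%MM]add0m addmK mpolyX0.
    by rewrite mevalZ meval1 mulr1.
  by rewrite mderivX mnm1E eq_sym (negPf ji) scale0r scaler0.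
have goodXn i k : good ('X_i ^+ k).
  elim: k => [|k IHk]; first by rewrite expr0 -mpolyC1.
  by rewrite exprS; apply: goodM.
elim/mpolyind: phi => [|c m phi _ _ IHphi]; first by rewrite -mpolyC0; apply: goodC.
apply: goodD => //; rewrite -mul_mpolyC; apply: (goodM _ _ (goodC c)).
by rewrite mpolyXE_id; apply: big_ind => //; rewrite -mpolyC1.
Qed.

Variable q : nat.
Hypothesis charFp : q.+1 \in [pchar F].

(** A derivative of order p - 1 of a form of degree p is a linear form; its value at v is therefore
    its derivative along v, and derivatives commute. *)
Lemma meval_mderivm_homog phi m v : phi \is q.+1.-homog -> mdeg m = q ->
  (phi^`M[m]).@[v] = ((dir_deriv v phi)^`M[m])@_0.
Proof.
move=> phiH mq; rewrite {1}(_ : phi^`M[m] = \sum_i (phi^`M[m])@_U_(i) *: 'X_i).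
  rewrite !raddf_sum /=; apply: eq_bigr => i _.
  rewrite mevalZ mevalXU mderivmZ mcoeffZ mulrC; congr (_ * _).
  rewrite -!mderivmU1m -mderivmDm addmC mderivmDm mderivmU1m mcoeff_mderiv.
  by rewrite add0m mnm0E.
apply/mpolyP=> k; rewrite raddf_sum /=.
have [/mdeg1P [j /eqP ->]|k1] := boolP (mdeg k == 1%N).
  rewrite (bigD1 j) //= big1 ?addr0 => [|i /negPf ij].
    by rewrite mcoeffZ mcoeffXU eqxx mulr1.
  by rewrite mcoeffZ mcoeffXU ij mulr0.
rewrite big1 => [|i _].
  rewrite mcoeff_mderivm (dhomog_nemf_coeff phiH) ?mul0rn //.
  by rewrite /= mdegD mq -addn1 eqn_add2l.
rewrite mcoeffZ mcoeffX; case: eqP => [ki|]; last by rewrite mulr0.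
by rewrite -ki mdeg1 in k1.
Qed.

(** The derivative of order m at v is m! times the coefficient at m of the derivative along v. Since
    m has degree p - 1, the factor m! is invertible, so if all of these vanish the directional
    derivative is zero. *)
Lemma p_regular_dir_deriv phi : phi \is q.+1.-homog ->
  (forall v, nonzero_point v -> dir_deriv v phi != 0) -> p_regular q.+1 phi.
Proof.
move=> phiH reg [v v0 phi_v]; have /eqP[] := reg v v0; apply/mpolyP=> m.
rewrite mcoeff0; have [mq|mq] := eqVneq (mdeg m) q; last first.
  rewrite raddf_sum big1 //= => i _; rewrite mcoeffZ mcoeff_mderiv.
  by rewrite (dhomog_nemf_coeff phiH) ?mul0rn ?mulr0 //= mdegD mdeg1 addn1.
have := phi_v m mq; rewrite meval_mderivm_homog // mcoeff_mderivm addm0.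
move/eqP; rewrite -mulr_natr mulf_eq0 => /orP[/eqP //|/idPn[]].
rewrite natr_prod; apply/prodf_neq0 => i _.
rewrite ffactnn -(dvdn_pcharf charFp).
rewrite prime_dvdn_fact ?(pcharf_prime charFp) // -ltnNge ltnS.
by rewrite -mq mdegE (bigD1 i) //= leq_addr.
Qed.

End PRegular.

(** Such a form is a multiple of x^p, whose derivative is zero. *)
Lemma p_regular_dim_neq1 (F : fieldType) q (charFp : q.+1 \in [pchar F])
  (phi : {mpoly F[1]}) :
  phi \is q.+1.-homog -> ~ p_regular q.+1 phi.
Proof.
move=> phiH; apply; exists (fun=> 1); first by exists ord0; rewrite oner_eq0.
move=> m mq; rewrite (meval_mderivm_homog _ phiH mq).
rewrite [X in X^`M[m]](_ : _ = 0) ?raddf0 //.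
apply/mpolyP=> k; rewrite /dir_deriv big_ord1 scale1r mcoeff_mderiv mcoeff0.
have [kq|kq] := eqVneq (mdeg k) q.
  have -> : k ord0 = q by rewrite -kq mdegE big_ord1.
  by rewrite -mulr_natr (pcharf0 charFp) mulr0.
by rewrite (dhomog_nemf_coeff phiH) ?mul0rn //= mdegD mdeg1 addn1.
Qed.

(** * The form attached to a sum of symbols *)

Lemma dhomog_prod_linear (R : comNzRingType) N k (f : 'I_k -> {mpoly R[N]}) :
  (forall i, f i \is 1.-homog) -> \prod_i f i \is k.-homog.
Proof.
move=> f1; suff: \prod_i f i \is (\sum_(i < k) 1)%N.-homog by rewrite sum1_card card_ord.
apply: (big_rec2 (fun g d => g \is d.-homog)) => [|i d g _ gd].
  exact: dhomog1.
exact: dhomogM.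
Qed.

(** * Homogeneity and p-regularity of the form *)

Section AlbertForm.

Variables (F : fieldType) (q : nat) (charFp : q.+1 \in [pchar F]).
Local Notation p := q.+1.
Variables (n : nat) (a b : 'I_n -> F) (C : 'I_n -> 'M[F]_p).

Let q_gt0 : (0 < q)%N.
Proof. by rewrite -ltnS prime_gt1 // (pcharf_prime charFp). Qed.

Local Notation dim := (2 + n * p)%N.

Definition block (i : 'I_n) (j : 'I_p) : 'I_dim := rshift 2 (mxvec_index i j).
Local Notation var0 := (lshift (n * p) ord0 : 'I_dim).
Local Notation var1 := (lshift (n * p) ord_max : 'I_dim).

(* The coefficients are mapped through f, so that one formula serves for the  *)
(* polynomial, for its values and for its restrictions to lines.              *)
Definition albert (S : comNzRingType) (f : F -> S) (y : 'I_dim -> S) : S :=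
  y var0 ^+ p - y var1 ^+ q * y var0 + f (\sum_i a i) * y var1 ^+ p
  + \sum_i f (b i) * \det (\sum_j y (block i j) *: map_mx f (C i ^+ j)).

Lemma rmorph_albert (S T : comNzRingType) (h : {rmorphism S -> T}) f y :
  h (albert f y) = albert (h \o f) (h \o y).
Proof.
rewrite /albert !rmorphD rmorphN !rmorphM !rmorphXn rmorph_sum /=.
congr (_ + _); apply: eq_bigr => i _; rewrite rmorphM -det_map_mx.
congr (_ * \det _); rewrite raddf_sum; apply: eq_bigr => j _ /=.
by rewrite map_mxZ -map_mx_comp.
Qed.

Definition albert_form : {mpoly F[dim]} := albert (@mpolyC _ F) (fun k => 'X_k).

Lemma albert_form_homog : albert_form \is p.-homog.
Proof.
have homX k : ('X_k : {mpoly F[dim]}) \is 1.-homog by rewrite dhomogX /= mdeg1.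
have homXp k : ('X_k : {mpoly F[dim]}) ^+ p \is p.-homog.
  by have := dhomogMn p (homX k); rewrite mul1n.
rewrite /albert_form /albert !mul_mpolyC.
apply: rpredD; last first.
  apply: rpred_sum => i _; rewrite mul_mpolyC; apply: dhomogZ.
  apply: rpred_sum => s _; rewrite rpredMsign; apply: dhomog_prod_linear => k.
  rewrite summxE; apply: rpred_sum => j _; rewrite !mxE mulrC mul_mpolyC.
  exact: dhomogZ.
apply: rpredD; last exact: dhomogZ.
apply: rpredB => //.
by have := dhomogM (dhomogMn q (homX var1)) (homX var0); rewrite mul1n addn1.
Qed.

Definition row_poly (w : 'I_p -> F) : {poly F} := \poly_(j < p) w (inord j).

Lemma horner_mx_row_poly (D : 'M[F]_p) w :
  horner_mx D (row_poly w) = \sum_j w j *: D ^+ j.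
Proof.
rewrite /row_poly poly_def raddf_sum /=; apply: eq_bigr => j _.
by rewrite linearZ /= rmorphXn /= horner_mx_X inord_val.
Qed.

Lemma row_poly_eq0 w : row_poly w = 0 -> w =1 fun=> 0.
Proof.
move=> w0 j; have := congr1 (fun g : {poly F} => g`_j) w0.
by rewrite coef_poly ltn_ord inord_val coef0.
Qed.

Lemma row_polyK (g : {poly F}) :
  (size g <= p)%N -> row_poly (fun j => g`_j) = g.
Proof.
move=> g_sz; apply/polyP=> k; rewrite coef_poly; case: ltnP => kp.
  by rewrite inordK.
by rewrite nth_default // (leq_trans g_sz).
Qed.

Lemma meval_albert_form v : albert_form.@[v] = 
  v var0 ^+ p - v var1 ^+ q * v var0 + (\sum_i a i) * v var1 ^+ p
  + \sum_i b i * \det (horner_mx (C i) (row_poly (fun j => v (block i j)))).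
Proof.
rewrite [LHS]rmorph_albert /albert /= !mevalC !mevalXU.
congr (_ + _); apply: eq_bigr => i _; rewrite mevalC horner_mx_row_poly.
congr (_ * \det _); apply: eq_bigr => j _; rewrite mevalXU.
by congr (_ *: _); apply/matrixP=> k l; rewrite !mxE /= mevalC.
Qed.

Hypothesis a_wp : forall i t, t ^+ p - t != a i.
Hypothesis charC : forall i, char_poly (C i) = artin_schreier_poly q (a i).

Lemma row_poly_block_unit i w : row_poly w != 0 ->
  exists h, horner_mx (C i) (h * row_poly w) = 1.
Proof.
by move=> w0; apply: (artin_schreier_norm_unit charFp (@a_wp i)); rewrite ?size_poly.
Qed.

Lemma block_norm_neq0 i w : row_poly w != 0 ->
  \det (horner_mx (C i) (row_poly w)) != 0.
Proof.
case/(row_poly_block_unit i) => h hw; apply/eqP=> dw.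
have := congr1 determinant hw; rewrite rmorphM det_mulmx dw mulr0 det1.
by move/esym/eqP; rewrite oner_eq0.
Qed.

Lemma block_matrix_wp i : C i ^+ p - C i = (a i)%:M.
Proof.
apply/eqP; rewrite -subr_eq0 -horner_mx_artin_schreier -charC.
by rewrite Cayley_Hamilton.
Qed.

Lemma var_cases k (P : 'I_dim -> Prop) :
  P var0 -> P var1 -> (forall i j, P (block i j)) -> P k.
Proof.
move=> P0 P1 Pb; case: (splitP k) => [j kj|j kj].
  have -> : k = lshift (n * p) j by apply: val_inj.
  by case: j {kj} => [[|[|//]] j2]; [move: P0|move: P1]; congr P; apply: val_inj.
have -> : k = rshift 2 j by apply: val_inj.
by case/mxvec_indexP: j {kj} => i j; apply: Pb.
Qed.

Definition point (c0 c1 : F) (G : 'M[F]_(n, p)) : 'I_dim -> F :=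
  fun k => row_mx (\row_(i < 2) (if i == ord0 then c0 else c1)) (mxvec G) 0 k.

Lemma point_var0 c0 c1 G : point c0 c1 G var0 = c0.
Proof. by rewrite /point row_mxEl mxE. Qed.

Lemma point_var1 c0 c1 G : point c0 c1 G var1 = c1.
Proof. by rewrite /point row_mxEl mxE. Qed.

Lemma point_block c0 c1 G i j : point c0 c1 G (block i j) = G i j.
Proof. by rewrite /point row_mxEr mxvecE. Qed.

Lemma line_block (D : 'M[F]_p) (w z : 'I_p -> F) :
  \sum_j ((w j)%:P + z j *: 'X) *: map_mx polyC (D ^+ j)
  = map_mx polyC (horner_mx D (row_poly w))
    + 'X *: map_mx polyC (horner_mx D (row_poly z)).
Proof.
rewrite !horner_mx_row_poly !raddf_sum -big_split; apply: eq_bigr => j _ /=.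
rewrite scalerDl !map_mxZ scalerA; congr (_ + _ *: _).
by rewrite mulrC mul_polyC.
Qed.

(** The determinant is a multiple of X^p, and p > 1. *)
Lemma deriv_line_block0 (D : 'M[F]_p) z :
  (\det ('X *: map_mx polyC (horner_mx D (row_poly z))))^`().[0] = 0.
Proof.
rewrite detZ derivM derivXn hornerD !hornerM hornerMn !hornerXn !expr0n /=.
by rewrite (gtn_eqF q_gt0) mul0rn !mul0r addr0.
Qed.

(** Take for w the coordinates of -C z in F[C]. The line w + X z is then (X - C) z, of norm (X^p - X
    - a) N(z), and X^p - X - a has derivative -1. *)
Lemma deriv_line_block (i : 'I_n) z : exists w : 'I_p -> F,
  (\det (map_mx polyC (horner_mx (C i) (row_poly w))
    + 'X *: map_mx polyC (horner_mx (C i) (row_poly z))))^`().[0]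
  = - \det (horner_mx (C i) (row_poly z)).
Proof.
pose f := artin_schreier_poly q (a i).
have f0 : f != 0 by rewrite -size_poly_eq0 size_artin_schreier_poly.
have fC : horner_mx (C i) f = 0 by rewrite -[f]charC Cayley_Hamilton.
pose g := (- 'X * row_poly z) %% f; exists (fun j => g`_j).
have g_sz : (size g <= p)%N.
  by rewrite -ltnS -(size_artin_schreier_poly charFp (a i)) ltn_modp.
have -> : horner_mx (C i) (row_poly (fun j => g`_j)) =
    - (C i *m horner_mx (C i) (row_poly z)).
  have := congr1 (horner_mx (C i)) (divp_eq (- 'X * row_poly z) f).
  rewrite row_polyK // rmorphD /= [horner_mx (C i) (_ * f)]rmorphM /= fC.
  rewrite mulr0 add0r => <-.
  by rewrite mulNr rmorphN rmorphM /= horner_mx_X.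
set M := horner_mx (C i) (row_poly z).
have -> : map_mx polyC (- (C i *m M)) + 'X *: map_mx polyC M =
    char_poly_mx (C i) *m map_mx polyC M.
  by rewrite map_mxN map_mxM mulmxBl mul_scalar_mx addrC.
rewrite det_mulmx det_map_mx -/(char_poly (C i)) charC derivM derivC mulr0 addr0.
have charXp : p \in [pchar {poly F}] by rewrite pchar_poly.
rewrite derivB derivXn derivD derivX derivC addr0 -mulr_natr (pcharf0 charXp).
by rewrite mulr0 sub0r mulN1r hornerN hornerC.
Qed.

(** The p-th powers disappear, and q = p - 1 equals -1 in F. *)
Lemma deriv_albert_head (A0 A1 : {poly F}) c x :
  (A0 ^+ p - A1 ^+ q * A0 + c%:P * A1 ^+ p)^`().[x]
  = A1^`().[x] * A1.[x] ^+ q.-1 * A0.[x] - A0^`().[x] * A1.[x] ^+ q.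
Proof.
have charXp : p \in [pchar {poly F}] by rewrite pchar_poly.
have derivXp (A : {poly F}) : (A ^+ p)^`() = 0.
  by rewrite deriv_exp -mulr_natr (pcharf0 charXp) mulr0.
have mulrnq (A : {poly F}) : A *+ q = - A.
  by apply/eqP; rewrite -addr_eq0 addrC -mulrS -mulr_natr (pcharf0 charXp) mulr0.
rewrite derivD derivB derivXp derivM derivC derivXp mul0r mulr0 !addr0 sub0r.
rewrite derivM deriv_exp mulrnq opprD mulNr opprK hornerD hornerN !hornerM.
by rewrite !horner_exp [in X in _ - X]mulrC.
Qed.

Lemma on_line_albert_form u v : on_line u v albert_form =
  ((u var0)%:P + v var0 *: 'X) ^+ p
  - ((u var1)%:P + v var1 *: 'X) ^+ q * ((u var0)%:P + v var0 *: 'X)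
  + (\sum_i a i)%:P * ((u var1)%:P + v var1 *: 'X) ^+ p
  + \sum_i (b i)%:P * \det (map_mx polyC
      (horner_mx (C i) (row_poly (fun j => u (block i j))))
    + 'X *: map_mx polyC
      (horner_mx (C i) (row_poly (fun j => v (block i j))))).
Proof.
have onX k : on_line u v 'X_k = (u k)%:P + v k *: 'X.
  by rewrite /on_line mmapX mmap1U.
have onC c : on_line u v c%:MP = c%:P by rewrite /on_line mmapC.
rewrite rmorph_albert /albert /= !onX onC; congr (_ + _).
apply: eq_bigr => i _; rewrite onC -line_block; congr (_ * \det _).
apply: eq_bigr => j _; rewrite onX; congr (_ *: _).
by apply/matrixP=> k l; rewrite !mxE /= onC.
Qed.

(** Suppose that the derivative along v is the zero polynomial. Evaluating it at suitable points u
    shows that every coordinate of v is 0. *)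
Lemma albert_form_regular : (forall i, b i != 0) -> p_regular p albert_form.
Proof.
move=> b0; apply: (p_regular_dir_deriv charFp albert_form_homog) => v [k vk].
apply: contraNneq vk => dv.
have derivL k' (u : 'I_dim -> F) : ((u k')%:P + v k' *: 'X)^`().[0] = v k'.
  by rewrite derivD derivC add0r derivZ derivX hornerZ hornerC mulr1.
have hornerL k' (u : 'I_dim -> F) : ((u k')%:P + v k' *: 'X).[0] = u k'.
  by rewrite hornerD hornerC hornerZ hornerX mulr0 addr0.
have dir0 u : v var1 * u var1 ^+ q.-1 * u var0 - v var0 * u var1 ^+ q
    + \sum_i b i * (\det (map_mx polyC
      (horner_mx (C i) (row_poly (fun j => u (block i j))))
    + 'X *: map_mx polyC
      (horner_mx (C i) (row_poly (fun j => v (block i j))))))^`().[0] = 0.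
  transitivity ((on_line u v albert_form)^`().[0]).
    rewrite on_line_albert_form derivD hornerD deriv_albert_head !derivL !hornerL.
    congr (_ + _); rewrite raddf_sum horner_sum; apply: eq_bigr => i _ /=.
    by rewrite derivM derivC mul0r add0r hornerM hornerC.
  by rewrite deriv_on_line0 dv meval0.
have row_poly0 w : w =1 (fun=> 0) -> row_poly w = 0.
  by move=> w0; apply/polyP=> j; rewrite coef_poly w0 if_same coef0.
have tail0 c0 c1 : \sum_i b i * (\det (map_mx polyC
      (horner_mx (C i) (row_poly (fun j => point c0 c1 0 (block i j))))
    + 'X *: map_mx polyC
      (horner_mx (C i) (row_poly (fun j => v (block i j))))))^`().[0] = 0.
  rewrite big1 // => i _; rewrite row_poly0 => [|j]; last by rewrite point_block mxE.
  by rewrite raddf0 map_mx0 add0r deriv_line_block0 mulr0.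
have v0 : v var0 = 0.
  have := dir0 (point 0 1 0); rewrite tail0 point_var0 point_var1 !expr1n.
  by rewrite mulr0 mulr1 sub0r addr0 => /eqP; rewrite oppr_eq0 => /eqP.
have v1 : v var1 = 0.
  have := dir0 (point 1 1 0); rewrite tail0 point_var0 point_var1 !expr1n v0.
  by rewrite mul0r !mulr1 subr0 addr0.
apply/eqP; apply: (@var_cases k (fun k => v k = 0)) => // i.
apply: row_poly_eq0; apply/eqP; apply: contraT => vi0.
(* The point u equal to w on block i and to 0 elsewhere gives - b_i N_i(v_i) = 0, against
   [block_norm_neq0]. *)
have [w dw] := deriv_line_block i (fun j => v (block i j)).
have := dir0 (point 0 0 (\matrix_(k, j) if k == i then w j else 0)).
rewrite (bigD1 i) //= big1 => [|k' k'i]; last first.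
  rewrite row_poly0 => [|j]; last by rewrite point_block mxE (negPf k'i).
  by rewrite raddf0 map_mx0 add0r deriv_line_block0 mulr0.
rewrite (_ : row_poly (fun j => point 0 0 _ (block i j)) = row_poly w); last first.
  by apply/polyP=> j; rewrite !coef_poly point_block mxE eqxx.
rewrite dw point_var0 point_var1 !expr0n (gtn_eqF q_gt0) !mulr0 subr0 add0r addr0.
move/eqP; rewrite mulrN oppr_eq0 mulf_eq0 (negPf (b0 i)) /=.
by rewrite (negPf (block_norm_neq0 i vi0)).
Qed.

End AlbertForm.

(** Nonzero blocks have nonzero norms, whose symbols with a_i vanish, so a zero of the form is the
    input of [sum_of_symbols_isotropic]. *)
Lemma isotropic_albert_form (F : fieldType) q (charFp : q.+1 \in [pchar F]) m
    (a b : 'I_m.+1 -> F) (C : 'I_m.+1 -> 'M[F]_q.+1) :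
    (forall i t, t ^+ q.+1 - t != a i) ->
    (forall i, char_poly (C i) = artin_schreier_poly q (a i)) ->
    (forall i, b i != 0) -> isotropic (albert_form a b C) ->
  sum_of_symbols (\sum_i symbol charFp (a i) (b i)) m.
Proof.
move=> a_wp charC b0 [v [k vk]]; rewrite meval_albert_form => v_iso.
pose g i := row_poly (fun j => v (block i j)).
apply: (@sum_of_symbols_isotropic _ _ _ _ a b
    (fun i => \det (horner_mx (C i) (g i))) (fun i => g i != 0)
    (v (lshift _ ord0)) (v (lshift _ ord_max))) => //.
- by move=> i; apply: (block_norm_neq0 charFp a_wp charC).
- move=> i gi; have [h hg] := row_poly_block_unit charFp a_wp charC i gi.
  exact: (symbol_horner_mx charFp (block_matrix_wp charC i) hg).
(* If c and all blocks were zero, the equation would read c0^p = 0 and the vector would be zero. *)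
- have [v1|] := eqVneq (v (lshift _ ord_max)) 0; last by left.
  right; apply: contrapT => noe.
  have g0 i : g i = 0.
    by apply/eqP; apply: contraT => gi; case: noe; exists i.
  move/eqP: vk; apply.
  apply: (@var_cases _ _ k (fun k => v k = 0)) => // [|i j].
    have q_gt0 : (0 < q)%N by rewrite -ltnS prime_gt1 // (pcharf_prime charFp).
    move: v_iso; rewrite v1 !expr0n (gtn_eqF q_gt0) mul0r subr0 mulr0 addr0.
    rewrite big1 ?addr0 => [|i _]; last by rewrite [row_poly _]g0 raddf0 det0 mulr0.
    by move/eqP; rewrite expf_eq0 => /andP[_ /eqP].
  exact: (row_poly_eq0 (g0 i)).
rewrite -[RHS]v_iso /=; congr (_ + _); rewrite big_mkcond /=.
apply: eq_bigr => i _; case: eqVneq => //= gi.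
by rewrite [row_poly _]gi raddf0 det0 mulr0.
Qed.

(** * Existence of symbol lengths and the bound *)

Section SymbolLength.

Variables (F : fieldType) (p : nat) (charFp : p \in [pchar F]).
Local Notation symbol := (symbol charFp).
Implicit Types x y : H2p charFp.

Lemma sum_of_symbols0 : sum_of_symbols (0 : H2p charFp) 0.
Proof. by exists (fun=> 0), (fun=> 1); split=> [[]|] //; rewrite big_ord0. Qed.

Lemma sum_of_symbols_symbol a b : b != 0 -> sum_of_symbols (symbol a b) 1.
Proof. by move=> b0; exists (fun=> a), (fun=> b); rewrite big_ord1. Qed.

Lemma sum_of_symbolsD x y m n :
  sum_of_symbols x m -> sum_of_symbols y n -> sum_of_symbols (x + y) (m + n).
Proof.
move=> [a [b [b0 ->]]] [a' [b' [b'0 ->]]].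
exists (fun i => match fintype.split i with inl j => a j | inr j => a' j end).
exists (fun i => match fintype.split i with inl j => b j | inr j => b' j end).
split=> [i|]; first by case: fintype.split.
rewrite big_split_ord /=; congr (_ + _); apply: eq_bigr => i _.
  by rewrite (unsplitK (inl _ i)).
by rewrite (unsplitK (inr _ i)).
Qed.

(** Forms are sums of terms a db, and a db has class [a b, b) when b != 0. *)
Lemma sum_of_symbols_ex x : exists n, sum_of_symbols x n.
Proof.
have [w ->] := proj_surj x; have [v ->] := proj_surj w; have [y ->] := proj_surj v.
rewrite -/(mod_exact F) -/(form_class charFp _).
rewrite -[y]freeg_sumE raddf_sum [form_class _ _]raddf_sum /=.
apply: (big_ind (fun x => exists n, sum_of_symbols x n)) =>
    [|x1 x2 [m hm] [n hn]|b _].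
- by exists 0%N; exact: sum_of_symbols0.
- by exists (m + n)%N; apply: sum_of_symbolsD.
have -> : proj (Kaehler_rel_subgroup F) << coeff b y *g b >> =
    coeff b y *: kdiff b.
  by rewrite /kdiff -Kaehler_projZ scale_freegU mulr1.
have [->|b0] := eqVneq b 0.
  by exists 0%N; rewrite [kdiff _]raddf0 scaler0 raddf0; exact: sum_of_symbols0.
by exists 1%N; rewrite -symbol_scaled //; apply: sum_of_symbols_symbol.
Qed.

Lemma symbol_length_ex x : exists n, symbol_length x n.
Proof.
have [n0 n0P] := sum_of_symbols_ex x.
have exP : exists n, `[< sum_of_symbols x n >] by exists n0; apply/asboolP.
case: (ex_minnP exP) => n /asboolP nP n_min; exists n; split=> // m mP.
by apply/n_min/asboolP.
Qed.

Lemma sum_of_symbols_drop_wp m (a b : 'I_m.+1 -> F) i t : (forall j, b j != 0) ->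
    a i = t ^+ p - t ->
  sum_of_symbols (\sum_j symbol (a j) (b j)) m.
Proof.
move=> b0 ai; exists (fun j => a (fintype.lift i j)), (fun j => b (fintype.lift i j)).
by split=> //; rewrite (bigD1_ord i) //= ai symbol_wp // add0r.
Qed.

End SymbolLength.

Lemma symbol_length_u_invariant (F : fieldType) p (charFp : p \in [pchar F]) u
    (x : H2p charFp) n :
  u_invariant F p u -> symbol_length x n -> (n * p + 2 <= u)%N.
Proof.
have [q def_p] : exists q, p = q.+1.
  by exists p.-1; rewrite prednK // prime_gt0 // (pcharf_prime charFp).
move: charFp x; rewrite {p}def_p => charFp x [[u0 [phi [phiH _ phi_reg]]] u_max].
case: n => [_|m [[a [b [b0 def_x]]] n_min]].
  case: u => [|[|u]] // in u0 phi phiH phi_reg u_max *.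
  by case: (p_regular_dim_neq1 charFp phiH phi_reg).
have not_sum : ~ sum_of_symbols x m by move/n_min; rewrite ltnn.
have a_wp i t : t ^+ q.+1 - t != a i.
  apply/eqP=> ai; apply: not_sum; rewrite def_x.
  exact: (sum_of_symbols_drop_wp _ b0 (esym ai)).
have exC i : exists C : 'M[F]_q.+1, char_poly C = artin_schreier_poly q (a i).
  apply: exists_char_poly; first exact: artin_schreier_poly_monic.
  exact: size_artin_schreier_poly.
have [C charC] := fin_all_exists exC.
rewrite addnC; apply: u_max; split=> //; exists (albert_form a b C); split.
- exact: albert_form_homog.
- move=> iso; apply: not_sum; rewrite def_x.
  exact: (isotropic_albert_form charFp a_wp charC).
- exact: albert_form_regular.
Qed.

Theorem corollary3p8 (p : nat) (pr_p : prime p) (F : fieldType)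
    (charFp : p \in [pchar F]) (u : nat) (hu : u_invariant F p u) :
  exists2 n : nat, H2p_symbol_length charFp n
                 & n%:Z <= Num.ceil ((u%:R - 1) / p%:R : rat) - 1.
Proof.
have p_gt0 := prime_gt0 pr_p.
(* The attained lengths are bounded by u, so their supremum is a maximum. *)
pose attained n := `[< exists x : H2p charFp, symbol_length x n >].
have attained_le n : attained n -> (n * p + 2 <= u)%N.
  by case/asboolP=> x; apply: symbol_length_u_invariant.
have exA : exists n, attained n.
  have [n nP] := symbol_length_ex (0 : H2p charFp).
  by exists n; apply/asboolP; exists 0.
have bound n : attained n -> (n <= u)%N.
  move/attained_le; apply: leq_trans; apply: leq_trans (leq_addr _ _).
  exact: leq_pmulr.
case: (ex_maxnP exA bound) => n An n_max; exists n.
  split=> [x|k kP].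
    have [m mP] := symbol_length_ex x; exists m => //.
    by apply: n_max; apply/asboolP; exists x.
  by have /asboolP[x] := An; apply: kP.
(* For an integer n, n + 1 <= ceil((u - 1) / p) means n < (u - 1) / p, that is n p + 1 < u. *)
rewrite lerBrDr lezD1 ceil_gt_int ltr_pdivlMr ?ltr0n // ltrBrDr -pmulrn.
by rewrite -natrM natr1 ltr_nat -addn2 attained_le.
Qed.
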